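(* Given a field $K$ and any affine algebraic variety $V$ over $K$, there exists a finite dimensional path algebra modulo relations, $\Lambda=K\Gamma/I$, together with a path $p$ in $K\Gamma$, such that $V\cong V_p$. We can, moreover, choose the quiver $\Gamma$ to be acyclic and without double arrows.
   Context: An affine algebraic variety over $K$ is the vanishing set in some affine space $\mathbb A^m(K)$ of a set of polynomials in $K[X_1,\dots,X_m]$; it is not required to be irreducible. An isomorphism between varieties is a homeomorphism (Zariski topology) which has regular coordinate functions in both directions. A quiver is without double arrows if no two distinct arrows have the same starting vertex and the same end vertex; it is acyclic if it has no oriented cycles of positive length. Setting. $\Gamma$ is a finite quiver, $I$ an admissible ideal of the path algebra $K\Gamma$, and $\Lambda=K\Gamma/I$, a finite dimensional algebra with Jacobson radical $J$ and Loewy length $L$ (the least integer with $J^L=0$). Vertices of $\Gamma$ are identified with the corresponding primitive idempotents (paths of length $0$). The product $qp$ of paths means ''$q$ after $p$'' (and is $0$ if this is not defined). A path $v$ is a right subpath of $p$ if $p=wv$ for some path $w$ (lengths $0$ allowed). Detours. A detour on a path $p$ is a pair $(\alpha,u)$, where $\alpha$ is an arrow and $u$ is a right subpath of $p$ (length $0$ allowed) such that (i) $\alpha u\ne0$ in $K\Gamma$; (ii) $\alpha u$ is not a right subpath of $p$; (iii) there is a right subpath $v$ of $p$ with $\mathrm{length}(v)\ge\mathrm{length}(u)+1$ whose endpoint equals the endpoint of $\alpha$. One writes $(\alpha,u)\wr\wr p$. For a detour $(\alpha,u)$ on $p$, $\{v_i(\alpha,u)\mid i\in I(\alpha,u)\}$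 is the family (indexed without repetition by the finite set $I(\alpha,u)$) of all right subpaths of $p$ that are longer than $u$ and have the same endpoint as $\alpha$. Routes. If $p$ passes consecutively through the vertices $e(1),\dots,e(l+1)$, a route on $p$ is a path in $K\Gamma$ (possibly $e(1)$ itself) which starts in $e(1)$ and whose sequence of consecutive vertices is a subsequence of $(e(1),\dots,e(l+1))$. The variety $V_p$. Let $X$ be the family of independent commuting variables $X_i(\alpha,u)$, $(\alpha,u)\wr\wr p$, $i\in I(\alpha,u)$, let $K[X]$ be the polynomial ring over $K$ and $K\Gamma[X]$ the polynomial ring with coefficients in $K\Gamma$. Let $\mathcal L(p)$ be the left ideal of $K\Gamma[X]$ generated by all paths that are not routes on $p$ together with all differences $\alpha u-\sum_{i\in I(\alpha,u)}X_i(\alpha,u)v_i(\alpha,u)$ for $(\alpha,u)\wr\wr p$. Each $z\in K\Gamma$ is congruent modulo $\mathcal L(p)$ to a unique element $\sum_{p'}\tau_{p'}(X)p'$ with $\tau_{p'}(X)\in K[X]$, where $p'$ runs through the right subpaths of $p$. Let $I^{(L)}$ be the $K$-subspace of $I$ consisting of those elements that are $K$-linear combinations of paths of length at most $L$, let $t_1,\dots,t_s$ be a $K$-spanning set of $I^{(L)}$, and let $\tau_{j,p'}(X)$ be the resulting polynomials for $t_j$. Then $V_p$ is the simultaneous vanishing locus of all $\tau_{j,p'}(X)$ in affine space $\mathbb A^N(K)$, $N=\sum_{(\alpha,u)\wr\wr p}|I(\alpha,u)|$ (with coordinates indexed by the variables $X_i(\alpha,u)$); it does not depend on the choice of $t_1,\dots,t_s$.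 *)

(* Defs.v *)
From HB Require Import structures.
From mathcomp Require Import all_boot all_algebra finmap.
From mathcomp.multinomials Require Import -(notations) monalg.
From mathcomp.multinomials Require Import mpoly.

Set Implicit Arguments.
Unset Strict Implicit.
Unset Printing Implicit Defensive.

Import GRing.Theory.
Local Open Scope fset_scope.
Local Open Scope ring_scope.

Record quiver := Quiver {
  qvert : finType;
  qarrow : finType;
  qsrc : qarrow -> qvert;
  qtgt : qarrow -> qvert }.

Section Paths.
Variable Q : quiver.

(* Arrows are listed in the order in which they are traversed: the path
   written a_l ... a_2 a_1 is the starting vertex of a_1 with [:: a_1; ...; a_l]. *)
Fixpoint walk (e : qvert Q) (s : seq (qarrow Q)) : bool :=
  if s is a :: s' then (qsrc a == e) && walk (qtgt a) s' else true.

Record qpath := QPath {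
  qpath_val : qvert Q * seq (qarrow Q);
  _ : walk qpath_val.1 qpath_val.2 }.

HB.instance Definition _ := [isSub for qpath_val].
HB.instance Definition _ := [Equality of qpath by <:].
HB.instance Definition _ := [Choice of qpath by <:].

Definition pstart (p : qpath) : qvert Q := (val p).1.
Definition parrows (p : qpath) : seq (qarrow Q) := (val p).2.
Definition plen (p : qpath) : nat := size (parrows p).
Definition pverts (p : qpath) : seq (qvert Q) :=
  pstart p :: [seq qtgt a | a <- parrows p].
Definition pend (p : qpath) : qvert Q :=
  last (pstart p) [seq qtgt a | a <- parrows p].

Definition vpath (e : qvert Q) : qpath := @QPath (e, [::]) isT.

Lemma walk_arrow (a : qarrow Q) : walk (qsrc a) [:: a].
Proof. by rewrite /= eqxx. Qed.
Definition apath (a : qarrow Q) : qpath := @QPath (qsrc a, [:: a]) (walk_arrow a).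

(* The product qp, "q after p"; None stands for an undefined product. *)
Definition pcomp (q p : qpath) : option qpath :=
  if pend p == pstart q then insub (pstart p, parrows p ++ parrows q) else None.

Lemma walk_cat e s1 s2 :
  walk e (s1 ++ s2) = walk e s1 && walk (last e [seq qtgt a | a <- s1]) s2.
Proof. by elim: s1 e => //= a s1 IH e; rewrite IH andbA. Qed.

Lemma walk_path (p : qpath) : walk (pstart p) (parrows p).
Proof. by case: p. Qed.

Lemma pcompP (q p : qpath) :
  if pend p == pstart q then
    exists r, [/\ pcomp q p = Some r, pstart r = pstart p
                & parrows r = parrows p ++ parrows q]
  else pcomp q p = None.
Proof.
rewrite /pcomp; case: eqP => // Epq.
have w : walk (pstart p, parrows p ++ parrows q).1
              (pstart p, parrows p ++ parrows q).2.
  by rewrite /= walk_cat walk_path /= -/(pend p) Epq walk_path.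
by exists (QPath w); rewrite insubT.
Qed.

Lemma qpath_inj (p q : qpath) :
  pstart p = pstart q -> parrows p = parrows q -> p = q.
Proof.
by move=> E1 E2; apply/val_inj; move: E1 E2; rewrite /pstart /parrows;
  case: (val p) (val q) => [? ?] [? ?] /= -> ->.
Qed.

Lemma pend_comp q p r : pcomp q p = Some r -> pend r = pend q.
Proof.
have := pcompP q p; case: eqP => [E [r' [-> E1 E2]] [<-]|_ -> //].
by rewrite /pend E1 E2 map_cat last_cat -/(pend p) E.
Qed.

Lemma pstart_comp q p r : pcomp q p = Some r -> pstart r = pstart p.
Proof. by have := pcompP q p; case: eqP => [E [r' [-> E1 E2]] [<-]|_ ->]. Qed.

Lemma pcompA q r s :
  obind (pcomp^~ s) (pcomp q r) = obind (pcomp q) (pcomp r s).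
Proof.
case Eqr: (pcomp q r) => [x|]; case Ers: (pcomp r s) => [y|] //=.
- have := pcompP x s; have := pcompP q y.
  rewrite (pend_comp Ers) (pstart_comp Eqr).
  have := pcompP q r; have := pcompP r s; rewrite Eqr Ers.
  case: eqP => // _ [y' [[<-] y1 y2]]; case: eqP => // _ [x' [[<-] x1 x2]].
  case=> z [-> z1 z2] [t [-> t1 t2]]; congr Some; apply: qpath_inj.
    by rewrite z1 t1 y1.
  by rewrite z2 t2 x2 y2 catA.
- have := pcompP x s; rewrite (pstart_comp Eqr).
  by have := pcompP r s; rewrite Ers; case: eqP => // _ [? []].
have := pcompP q y; rewrite (pend_comp Ers).
by have := pcompP q r; rewrite Eqr; case: eqP => // _ [? []].
Qed.

Lemma pcomp1p e p : pcomp (vpath e) p = if pend p == e then Some p else None.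
Proof.
have := pcompP (vpath e) p; rewrite {2}/pstart /=; case: eqP => // _ [r [-> E1 E2]].
by congr Some; apply: qpath_inj; rewrite // E2 cats0.
Qed.

Lemma pcompp1 e p : pcomp p (vpath e) = if e == pstart p then Some p else None.
Proof.
have := pcompP p (vpath e); rewrite {1}/pend /=; case: eqP => // E [r [-> E1 E2]].
by congr Some; apply: qpath_inj; rewrite // E1.
Qed.

Lemma walk_take e s k : walk e s -> walk e (take k s).
Proof. by rewrite -{1}(cat_take_drop k s) walk_cat => /andP[]. Qed.

(* v is a right subpath of p if p = wv for some w; these v are the initial
   segments of p, one of each length k <= plen p. *)
Definition rsub (p : qpath) (k : 'I_(plen p).+1) : qpath :=
  @QPath (pstart p, take k (parrows p)) (walk_take k (walk_path p)).

Lemma rsubP (p v : qpath) :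
  (exists w, pcomp w v = Some p) <-> (exists k, v = rsub (p := p) k).
Proof.
split=> [[w]|[k ->]].
  have := pcompP w v; case: eqP => [_ [r [-> E1 E2]] [Er]|_ -> //].
  have lt_k : (plen v < (plen p).+1)%N.
    by rewrite ltnS /plen -Er E2 size_cat leq_addr.
  exists (Ordinal lt_k); apply: qpath_inj; first by rewrite -E1 Er.
  by rewrite -[RHS]/(take (plen v) (parrows p)) -Er E2 take_size_cat.
pose e := last (pstart p) [seq qtgt a | a <- take k (parrows p)].
have w : walk (e, drop k (parrows p)).1 (e, drop k (parrows p)).2.
  by have := walk_path p; rewrite -{1}(cat_take_drop k (parrows p)) walk_cat
    => /andP[].
exists (QPath w); have := pcompP (QPath w) (rsub k).
have -> : pend (rsub k) = pstart (QPath w) by [].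
rewrite eqxx => -[r [-> E1 E2]].
by congr Some; apply: qpath_inj; rewrite // E2 cat_take_drop.
Qed.

Lemma plen_rsub (p : qpath) (k : 'I_(plen p).+1) : plen (rsub k) = k.
Proof. by rewrite /plen size_takel // -ltnS. Qed.

Definition route (p q : qpath) : bool :=
  (pstart q == pstart p) && subseq (pverts q) (pverts p).

(* The right subpath u of a detour (a, u) on p is given by its length. *)
Definition detour (p : qpath) (a : qarrow Q) (u : 'I_(plen p).+1) : bool :=
  [&& pcomp (apath a) (rsub u) != None,
      [forall v : 'I_(plen p).+1, pcomp (apath a) (rsub u) != Some (rsub v)]
    & [exists v : 'I_(plen p).+1, (u < v)%N && (pend (rsub v) == qtgt a)]].

(* The index set of the variables X_i(a, u): triples (a, u, v) such that (a, u)
   is a detour on p and v = v_i(a, u) runs through the right subpaths of p that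
   are longer than u and end where a ends. *)
Definition is_dvar (p : qpath) :
    pred (qarrow Q * 'I_(plen p).+1 * 'I_(plen p).+1) :=
  fun d => [&& detour d.1.1 d.1.2, (d.1.2 < d.2)%N
             & pend (rsub d.2) == qtgt d.1.1].

Definition dvar (p : qpath) : finType := {d | is_dvar (p := p) d}.

End Paths.

Arguments pcomp {Q} q p.
Arguments route {Q} p q.

Definition acyclic (Q : quiver) : Prop :=
  forall c : qpath Q, pend c = pstart c -> plen c = 0%N.

Definition no_double_arrows (Q : quiver) : Prop :=
  forall a b : qarrow Q, qsrc a = qsrc b -> qtgt a = qtgt b -> a = b.

Definition palg (R : nzRingType) (Q : quiver) := malg (qpath Q) R.

(* The module structure is that of malg (qpath Q) R, with the operations locked
   in order to keep unification away from their implementation. *)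
HB.lock Definition palg_add (R : nzRingType) (Q : quiver) (x y : palg R Q) : palg R Q :=
  ((x : malg (qpath Q) R) + (y : malg (qpath Q) R))%R.
HB.lock Definition palg_opp (R : nzRingType) (Q : quiver) (x : palg R Q) : palg R Q :=
  (- (x : malg (qpath Q) R))%R.
HB.lock Definition palg_zero (R : nzRingType) (Q : quiver) : palg R Q :=
  (0 : malg (qpath Q) R).
HB.lock Definition palg_scale (R : nzRingType) (Q : quiver) (c : R) (x : palg R Q) : palg R Q :=
  (c *: (x : malg (qpath Q) R))%R.

Section PathModule.
Variables (R : nzRingType) (Q : quiver).

Fact palg_addA : associative (@palg_add R Q).
Proof. by move=> x y z; rewrite palg_add.unlock; exact: addrA. Qed.
Fact palg_addC : commutative (@palg_add R Q).
Proof. by move=> x y; rewrite palg_add.unlock; exact: addrC. Qed.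
Fact palg_add0 : left_id (palg_zero R Q) (@palg_add R Q).
Proof. by move=> x; rewrite palg_add.unlock palg_zero.unlock; exact: add0r. Qed.
Fact palg_addN : left_inverse (palg_zero R Q) (@palg_opp R Q) (@palg_add R Q).
Proof.
by move=> x; rewrite palg_add.unlock palg_zero.unlock palg_opp.unlock; exact: addNr.
Qed.

HB.instance Definition _ := Choice.on (palg R Q).
HB.instance Definition _ :=
  GRing.isZmodule.Build (palg R Q) palg_addA palg_addC palg_add0 palg_addN.

Fact palg_scaleA (c d : R) (x : palg R Q) :
  palg_scale c (palg_scale d x) = palg_scale (c * d) x.
Proof. by rewrite palg_scale.unlock; exact: scalerA. Qed.
Fact palg_scale1 : left_id 1 (@palg_scale R Q).
Proof. by move=> x; rewrite palg_scale.unlock; exact: scale1r. Qed.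
Fact palg_scaleDr : right_distributive (@palg_scale R Q) +%R.
Proof.
move=> c x y; rewrite /GRing.add /= palg_scale.unlock palg_add.unlock.
exact: scalerDr.
Qed.
Fact palg_scaleDl (x : palg R Q) :
  {morph (fun c => palg_scale c x) : c d / c + d}.
Proof.
move=> c d; rewrite [in RHS]/GRing.add /= palg_scale.unlock palg_add.unlock.
exact: scalerDl.
Qed.

HB.instance Definition _ := GRing.Zmodule_isLmodule.Build R (palg R Q)
  palg_scaleA palg_scale1 palg_scaleDr palg_scaleDl.

End PathModule.

(* pcoef q x is the coefficient of the path q in x, and psupp x the set of
   paths with a non-zero coefficient. *)
Definition pcoef (R : nzRingType) (Q : quiver) (q : qpath Q) (x : palg R Q) : R :=
  monalg.mcoeff q x.
Definition psupp (R : nzRingType) (Q : quiver) (x : palg R Q) : {fset qpath Q} :=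
  monalg.msupp x.

HB.lock Definition pbasis (R : nzRingType) (Q : quiver) (q : qpath Q) : palg R Q :=
  @mkmalgU (qpath Q) R q 1.

Definition obasis (R : nzRingType) (Q : quiver) (o : option (qpath Q)) : palg R Q :=
  if o is Some q then pbasis R q else 0.

HB.lock Definition palg_mul (R : nzRingType) (Q : quiver) (x y : palg R Q) : palg R Q :=
  \sum_(q <- psupp x) \sum_(r <- psupp y)
     (pcoef q x * pcoef r y) *: obasis R (pcomp q r).

Section PathAlgebra.
Variables (R : nzRingType) (Q : quiver).
Implicit Types (x y z : palg R Q) (q r s : qpath Q).

Lemma palgP x y : (forall q, pcoef q x = pcoef q y) <-> x = y.
Proof. exact: malgP. Qed.

Lemma pcoef0 q : pcoef q (0 : palg R Q) = 0.
Proof. by rewrite /GRing.zero /= palg_zero.unlock; exact: monalg.mcoeff0. Qed.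

Lemma pcoefD q x y : pcoef q (x + y) = pcoef q x + pcoef q y.
Proof. by rewrite {1}/GRing.add /= palg_add.unlock; exact: monalg.mcoeffD. Qed.

Lemma pcoefZ q c x : pcoef q (c *: x) = c * pcoef q x.
Proof. by rewrite /GRing.scale /= palg_scale.unlock; exact: monalg.mcoeffZ. Qed.

Lemma pcoef_basis q r : pcoef q (pbasis R r) = (r == q)%:R.
Proof. by rewrite pbasis.unlock; exact: (@monalg.mcoeffU (qpath Q) R r 1 q). Qed.

Lemma psuppP q x : (q \in psupp x) = (pcoef q x != 0).
Proof. by rewrite -monalg.mcoeff_neq0. Qed.

Lemma pcoef_sum q I (t : seq I) (F : I -> palg R Q) :
  pcoef q (\sum_(i <- t) F i) = \sum_(i <- t) pcoef q (F i).
Proof. exact: (big_morph (pcoef q) (pcoefD q) (pcoef0 q)). Qed.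

Lemma palgE x : x = \sum_(q <- psupp x) pcoef q x *: pbasis R q.
Proof.
apply/palgP=> k; rewrite pcoef_sum.
have [kx|kx] := boolP (k \in psupp x).
  rewrite (big_fsetD1 k) //= pcoefZ pcoef_basis eqxx mulr1 big1_fset ?addr0 // => q.
  by rewrite in_fsetD1 pcoefZ pcoef_basis => /andP[/negPf-> _]; rewrite mulr0.
rewrite big1_fset => [|q qx _]; first by apply/eqP; rewrite -[_ == _]negbK -psuppP.
rewrite pcoefZ pcoef_basis; case: (q =P k) qx kx => [-> -> //|]; by rewrite mulr0.
Qed.

Definition palg_one : palg R Q := \sum_(e : qvert Q) pbasis R (vpath e).

Lemma palg_mulEw (d1 d2 : {fset qpath Q}) x y :
  psupp x `<=` d1 -> psupp y `<=` d2 ->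
  palg_mul x y =
    \sum_(q <- d1) \sum_(r <- d2)
       (pcoef q x * pcoef r y) *: obasis R (pcomp q r).
Proof.
have coef0 q z : q \notin psupp z -> pcoef q z = 0.
  by rewrite psuppP negbK => /eqP.
move=> le1 le2; rewrite palg_mul.unlock (big_fset_incl _ le1) /=.
  apply/eq_bigr=> k _; apply/big_fset_incl => // r _ /coef0 ->.
  by rewrite mulr0 scale0r.
move=> k _ /coef0 xk.
by rewrite big1 => // r _; rewrite xk mul0r scale0r.
Qed.

Lemma psuppD_le x y : psupp (x + y) `<=` psupp x `|` psupp y.
Proof.
apply/fsubsetP=> q; rewrite in_fsetU !psuppP pcoefD -negb_and.
by apply: contra => /andP[/eqP-> /eqP->]; rewrite addr0.
Qed.

Lemma psuppZ_le c x : psupp (c *: x) `<=` psupp x.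
Proof.
apply/fsubsetP=> q; rewrite !psuppP pcoefZ.
by apply: contra => /eqP->; rewrite mulr0.
Qed.

Lemma psupp_basis_le q : psupp (pbasis R q) `<=` [fset q].
Proof.
apply/fsubsetP=> r; rewrite psuppP pcoef_basis => ne0; apply/fset1P.
by case: (q =P r) ne0 => // _; rewrite eqxx.
Qed.

Lemma palg_mulDl : left_distributive (@palg_mul R Q) +%R.
Proof.
move=> x y z.
rewrite (palg_mulEw (psuppD_le x y) (fsubset_refl (psupp z))).
rewrite (palg_mulEw (fsubsetUl _ (psupp y)) (fsubset_refl (psupp z))).
rewrite (palg_mulEw (fsubsetUr (psupp x) (psupp y)) (fsubset_refl (psupp z))).
rewrite -big_split /=; apply/eq_bigr=> q _.
rewrite -big_split /=; apply/eq_bigr=> r _.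
by rewrite pcoefD mulrDl scalerDl.
Qed.

Lemma palg_mulDr : right_distributive (@palg_mul R Q) +%R.
Proof.
move=> z x y.
rewrite (palg_mulEw (fsubset_refl (psupp z)) (psuppD_le x y)).
rewrite (palg_mulEw (fsubset_refl (psupp z)) (fsubsetUl _ (psupp y))).
rewrite (palg_mulEw (fsubset_refl (psupp z)) (fsubsetUr (psupp x) (psupp y))).
rewrite -big_split /=; apply/eq_bigr=> q _.
rewrite -big_split /=; apply/eq_bigr=> r _.
by rewrite pcoefD mulrDr scalerDl.
Qed.

Lemma palg_mul0l : left_zero 0 (@palg_mul R Q).
Proof.
move=> x; apply: (addIr (palg_mul 0 x)).
by rewrite -palg_mulDl addr0 add0r.
Qed.

Lemma palg_mul0r : right_zero 0 (@palg_mul R Q).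
Proof.
move=> x; apply: (addIr (palg_mul x 0)).
by rewrite -palg_mulDr addr0 add0r.
Qed.

Lemma palg_mulZl c x y : c *: palg_mul x y = palg_mul (c *: x) y.
Proof.
rewrite (palg_mulEw (psuppZ_le c x) (fsubset_refl (psupp y))).
rewrite (palg_mulEw (fsubset_refl (psupp x)) (fsubset_refl (psupp y))).
rewrite scaler_sumr; apply/eq_bigr=> q _.
rewrite scaler_sumr; apply/eq_bigr=> r _.
by rewrite pcoefZ scalerA mulrA.
Qed.

Lemma palg_mulUZ c q y :
  palg_mul (pbasis R q) (c *: y) = c *: palg_mul (pbasis R q) y.
Proof.
rewrite (palg_mulEw (psupp_basis_le q) (psuppZ_le c y)).
rewrite (palg_mulEw (psupp_basis_le q) (fsubset_refl (psupp y))) !big_seq_fset1.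
rewrite scaler_sumr; apply/eq_bigr=> r _.
by rewrite pcoefZ pcoef_basis eqxx !mul1r scalerA.
Qed.

Lemma palg_mulUU q r :
  palg_mul (pbasis R q) (pbasis R r) = obasis R (pcomp q r).
Proof.
rewrite (palg_mulEw (psupp_basis_le q) (psupp_basis_le r)) !big_seq_fset1.
by rewrite !pcoef_basis !eqxx mulr1 scale1r.
Qed.

Lemma palg_mulUO q o :
  palg_mul (pbasis R q) (obasis R o) = obasis R (obind (pcomp q) o).
Proof. by case: o => [r|] /=; rewrite ?palg_mulUU ?palg_mul0r. Qed.

Lemma palg_mulSl I (t : seq I) (F : I -> palg R Q) y :
  palg_mul (\sum_(i <- t) F i) y = \sum_(i <- t) palg_mul (F i) y.
Proof.
exact: (big_morph (@palg_mul R Q ^~ y) (fun _ _ => palg_mulDl _ _ _) (palg_mul0l _)).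
Qed.

Lemma palg_mulSr I (t : seq I) (F : I -> palg R Q) x :
  palg_mul x (\sum_(i <- t) F i) = \sum_(i <- t) palg_mul x (F i).
Proof.
exact: (big_morph (palg_mul x) (fun _ _ => palg_mulDr _ _ _) (palg_mul0r _)).
Qed.

Lemma palg_mulA : associative (@palg_mul R Q).
Proof.
move=> x y z.
rewrite (palgE x) !palg_mulSl; apply/eq_bigr=> q _.
rewrite -!palg_mulZl; congr (_ *: _).
rewrite (palgE y) palg_mulSl !palg_mulSr palg_mulSl; apply/eq_bigr=> r _.
rewrite palg_mulUZ -!palg_mulZl palg_mulUZ; congr (_ *: _).
rewrite (palgE z) !palg_mulSr; apply/eq_bigr=> s _.
rewrite !palg_mulUZ !palg_mulUU palg_mulUO -pcompA.
case: (pcomp q r) => [t|] /=; last by rewrite palg_mul0l scaler0.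
by rewrite palg_mulUZ palg_mulUU.
Qed.

Lemma palg_mul1l : left_id palg_one (@palg_mul R Q).
Proof.
move=> x; rewrite {2}(palgE x) {1}(palgE x) palg_mulSr; apply/eq_bigr=> q _.
rewrite /palg_one palg_mulSl (bigD1 (pend q)) //= palg_mulUZ palg_mulUU pcomp1p eqxx.
rewrite big1 ?addr0 // => e ne.
by rewrite palg_mulUZ palg_mulUU pcomp1p eq_sym (negPf ne) scaler0.
Qed.

Lemma palg_mul1r : right_id palg_one (@palg_mul R Q).
Proof.
move=> x; rewrite {2}(palgE x) {1}(palgE x) palg_mulSl; apply/eq_bigr=> q _.
rewrite -palg_mulZl; congr (_ *: _).
rewrite /palg_one palg_mulSr (bigD1 (pstart q)) //= palg_mulUU pcompp1 eqxx /=.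
by rewrite big1 ?addr0 // => e ne; rewrite palg_mulUU pcompp1 (negPf ne).
Qed.

HB.instance Definition _ := GRing.Zmodule_isPzRing.Build (palg R Q)
  palg_mulA palg_mul1l palg_mul1r palg_mulDl palg_mulDr.

Lemma scaler_mulAl c x y : c *: (x * y) = (c *: x) * y.
Proof. exact: palg_mulZl. Qed.

Lemma pbasisM q r : pbasis R q * pbasis R r = obasis R (pcomp q r).
Proof. exact: palg_mulUU. Qed.

End PathAlgebra.

Section Ideals.
Variable A : pzRingType.
Implicit Types (I M N G : A -> Prop).

Definition left_ideal M : Prop :=
  [/\ M 0, forall x y, M x -> M y -> M (x + y) & forall a x, M x -> M (a * x)].

Definition two_sided_ideal M : Prop :=
  left_ideal M /\ forall a x, M x -> M (x * a).

Definition generated_left_ideal G : A -> Prop :=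
  fun x => forall M, left_ideal M -> (forall g, G g -> M g) -> M x.

Definition maximal_left_ideal M : Prop :=
  [/\ left_ideal M, ~ M 1
    & forall N, left_ideal N -> (forall x, M x -> N x) ->
        N 1 \/ (forall x, N x -> M x)].

(* For a two-sided ideal I: the inverse image in A of the Jacobson radical J of
   the ring A/I, whose maximal left ideals are the M/I with M as below. *)
Definition jacobson_quotient I : A -> Prop :=
  fun x => forall M, maximal_left_ideal M -> (forall y, I y -> M y) -> M x.

(* J^n = 0 in A/I. *)
Definition jacobson_power_zero I (n : nat) : Prop :=
  forall x : 'I_n -> A, (forall i, jacobson_quotient I (x i)) -> I (\prod_i x i).

Definition loewy_length I (L : nat) : Prop :=
  jacobson_power_zero I L /\ forall n, jacobson_power_zero I n -> (L <= n)%N.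

End Ideals.

(* The n-th power of the ideal of KQ generated by the arrows. *)
Definition arrow_ideal_power (K : fieldType) (Q : quiver) (n : nat) (x : palg K Q) : Prop :=
  forall q, q \in psupp x -> (n <= plen q)%N.

Definition admissible (K : fieldType) (Q : quiver) (I : palg K Q -> Prop) : Prop :=
  [/\ two_sided_ideal I,
      forall x, I x -> arrow_ideal_power 2 x
    & exists n, forall x, arrow_ideal_power n x -> I x].

Section Varieties.
Variable K : fieldType.

Definition zero_locus (m : nat) (S : {mpoly K[m]} -> Prop) : {ffun 'I_m -> K} -> Prop :=
  fun x => forall F, S F -> F.@[x] = 0.

Definition affine_variety (m : nat) (V : {ffun 'I_m -> K} -> Prop) : Prop :=
  exists S : {mpoly K[m]} -> Prop, forall x, V x <-> zero_locus S x.

(* Continuity for the subspace topology on V; the Zariski closed subsets of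
   affine space are its affine varieties. *)
Definition zariski_continuous_on (m n : nat) (V : {ffun 'I_m -> K} -> Prop)
    (f : {ffun 'I_m -> K} -> {ffun 'I_n -> K}) : Prop :=
  forall C, affine_variety C ->
    exists D, affine_variety D /\ forall x, V x -> (C (f x) <-> D x).

(* Regular functions on a closed subset of affine space are taken to be the
   restrictions of polynomials. *)
Definition regular_on (m : nat) (V : {ffun 'I_m -> K} -> Prop)
    (h : {ffun 'I_m -> K} -> K) : Prop :=
  exists F : {mpoly K[m]}, forall x, V x -> h x = F.@[x].

Definition variety_iso (m n : nat) (V : {ffun 'I_m -> K} -> Prop)
    (W : {ffun 'I_n -> K} -> Prop) : Prop :=
  exists (f : {ffun 'I_m -> K} -> {ffun 'I_n -> K})
         (g : {ffun 'I_n -> K} -> {ffun 'I_m -> K}),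
    [/\ (forall x, V x -> W (f x)) /\ (forall y, W y -> V (g y)),
        (forall x, V x -> g (f x) = x) /\ (forall y, W y -> f (g y) = y),
        zariski_continuous_on V f /\ zariski_continuous_on W g
      & (forall i, regular_on V (fun x => f x i)) /\
        (forall i, regular_on W (fun y => g y i))].

End Varieties.

Section UniserialVariety.
Variables (K : fieldType) (Q : quiver) (p : qpath Q).

Definition nvar : nat := #|dvar p|.

(* KQ[X], realized as K[X]Q: finite K[X]-linear combinations of paths. *)
Notation KX := {mpoly K[nvar]}.
Notation KQX := (palg KX Q).

Definition dX (d : dvar p) : KX := 'X_(enum_rank d).

Definition const_ext (z : palg K Q) : KQX :=
  \sum_(q <- psupp z) (pcoef q z)%:MP *: pbasis KX q.

Definition Lp_generator (z : KQX) : Prop :=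
  (exists2 q, ~~ route p q & z = pbasis KX q) \/
  (exists a u, detour (p := p) a u /\
     z = pbasis KX (apath a) * pbasis KX (rsub u)
         - \sum_(d : dvar p | (val d).1 == (a, u)) dX d *: pbasis KX (rsub (val d).2)).

Definition Lp : KQX -> Prop := generated_left_ideal Lp_generator.

(* The family tau of polynomials is the one attached to z. *)
Definition normal_form (z : palg K Q) (tau : 'I_(plen p).+1 -> KX) : Prop :=
  Lp (const_ext z - \sum_k tau k *: pbasis KX (rsub k)).

Definition bounded_part (I : palg K Q -> Prop) (L : nat) : palg K Q -> Prop :=
  fun z => I z /\ forall q, q \in psupp z -> (plen q <= L)%N.

Definition spanning (P : palg K Q -> Prop) (s : nat) (t : 'I_s -> palg K Q) : Prop :=
  (forall j, P (t j)) /\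
  (forall z, P z -> exists c : 'I_s -> K, z = \sum_j c j *: t j).

(* W is V_p for the algebra KQ/I of Loewy length L. *)
Definition is_Vp (I : palg K Q -> Prop) (L : nat) (W : {ffun 'I_nvar -> K} -> Prop) : Prop :=
  exists (s : nat) (t : 'I_s -> palg K Q) (tau : 'I_s -> 'I_(plen p).+1 -> KX),
    [/\ spanning (bounded_part I L) t,
        forall j, normal_form (t j) (tau j)
      & forall x, W x <-> zero_locus (fun F => exists j k, F = tau j k) x].

End UniserialVariety.

Arguments is_Vp {K Q} p I L W.

(* Main.v *)
From Pilot Require Import Defs.
From mathcomp Require Import all_boot all_algebra.
From mathcomp Require Import all_order finmap zify.
From mathcomp.multinomials Require Import mpoly.
From Stdlib Require Import Classical.

Set Implicit Arguments.
Unset Strict Implicit.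
Unset Printing Implicit Defensive.

(* Makes [pcomp] the product of paths again, instead of the composition of partial
   functions. *)
Import Pilot.Defs.
Import Order.TTheory GRing.Theory.
Local Open Scope ring_scope.

(** The polynomials that cut out V_p are read off from paths. Take an acyclic
quiver all of whose vertices lie on p, with p running from a source to a sink.
Modulo the left ideal of p, an arrow that shortcuts p multiplies by its own
variable, and an arrow of p by 1. Hence a path from the first to the last vertex
of p is congruent to a monomial times p: the product of the variables of the
shortcuts it takes. So a linear combination of such paths, as an element of the
ideal I, imposes on V_p the vanishing of the corresponding combination of
monomials. As the paths from the source to the sink admit no further
multiplication, the linear span of any set of these combinations is already a
two-sided ideal; it is admissible as soon as the paths have length at least 2.

The quiver used here, the ladder, consists of the path p = (0 -> 1 -> ... -> 2T+2)
and of the shortcuts 2t -> 2t+2 for t < T. The shortcuts do not overlap, so each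
subset of them is taken by some path, and every squarefree monomial in T
variables occurs ([monomial_path]). The last two arrows of p make
all these paths long enough, even for T = 0. Thus every finite system of
polynomials of degree at most 1 in each variable is the system of equations of
some V_p ([multilinear_realization]). Two more points need care there:
arrows lie in the Jacobson radical because left multiples of arrows are
nilpotent ([arrow_jacobson]), and the Loewy length is at least the
length of p, hence no relation is lost in passing to the bounded part of I
([loewy_length_ge]).

An arbitrary affine variety is the zero set of finitely many polynomials, by
Hilbert's basis theorem ([hilbert_basis]), deduced here from Dickson's lemma by
division with respect to leading monomials. Replacing each variable by many
copies, one for each factor of a power, makes the polynomials squarefree; the
equations that identify the copies are themselves combinations of squarefree
monomials, and duplicating coordinates is an isomorphism onto the variety so
obtained. *)

(** * Noetherianity of polynomial rings *)

(** Induction on the number [k] of coordinates compared: a basis for the first [k]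
coordinates also serves in coordinate [k] for the elements above some bound [B],
and the elements below [B] lie in [B] slices on which coordinate [k] is constant.
The exponents are attached to arbitrary objects by [h], so that a basis of leading
monomials comes with polynomials that have them. *)
Lemma dickson (T : eqType) (k : nat) (h : T -> nat -> nat) (A : T -> Prop) :
  exists s : seq T, (forall y, y \in s -> A y) /\
    forall x, A x -> exists2 y, y \in s & forall i, (i < k)%N -> (h y i <= h x i)%N.
Proof.
elim: k A => [|k IH] A.
  have [[x Ax]|noA] := classic (exists x, A x).
    by exists [:: x]; split=> [y /[!inE] /eqP->|y _] //; exists x; rewrite ?inE.
  by exists [::]; split=> // x Ax; case: noA; exists x.
have [s [sA sP]] := IH A.
pose B := (\max_(y <- s) h y k)%N.
have [t [tA tP]] : exists t : seq T, (forall y, y \in t -> A y) /\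
    forall x, A x -> (h x k < B)%N ->
      exists2 y, y \in t & forall i, (i < k.+1)%N -> (h y i <= h x i)%N.
  elim: B => [|b [t [tA tP]]]; first by exists [::].
  have [r [rA rP]] := IH (fun x => A x /\ h x k = b).
  exists (r ++ t); split=> [y|x Ax]; rewrite ?mem_cat.
    by case/orP=> [/rA[]|/tA].
  rewrite ltnS leq_eqVlt => /orP[/eqP xb|/(tP _ Ax)[y yt yx]]; last first.
    by exists y => //; rewrite mem_cat yt orbT.
  have [y yr yx] := rP x (conj Ax xb).
  exists y => [|i]; first by rewrite mem_cat yr.
  rewrite ltnS leq_eqVlt => /orP[/eqP->|/yx] //.
  by have [_ ->] := rA y yr; rewrite xb.
exists (s ++ t); split=> [y|x Ax]; rewrite ?mem_cat.
  by case/orP=> [/sA|/tA].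
have [xB|Bx] := ltnP (h x k) B.
  by have [y yt yx] := tP x Ax xB; exists y => //; rewrite mem_cat yt orbT.
have [y ys yx] := sP x Ax; exists y => [|i]; first by rewrite mem_cat ys.
rewrite ltnS leq_eqVlt => /orP[/eqP->|/yx] //.
by apply: leq_trans Bx; rewrite /B; exact: (@leq_bigmax_seq _ s xpredT (h^~ k)).
Qed.

(** Division: finitely many elements of [A] have leading monomials that divide all
leading monomials of [A] (Dickson), so a suitable multiple of one of them
cancels the leading term of a given element of [A], and one concludes by
induction on the leading monomial, the monomial order being well-founded. *)
Lemma hilbert_basis (K : fieldType) (n : nat) (A : {mpoly K[n]} -> Prop) :
  left_ideal A ->
  exists fs : seq {mpoly K[n]}, (forall f, f \in fs -> A f) /\
    forall F, A F -> generated_left_ideal (fun f => f \in fs) F.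
Proof.
case=> A0 AD AM.
have [fs [fsA fsP]] := dickson n (fun (f : {mpoly K[n]}) i => nth 0%N (mlead f) i)
                         (fun f => A f /\ f != 0).
exists fs; split=> [f /fsA[] //|F AF M Mid Mfs].
case: (Mid) => M0 MD MM.
have [m le_m] := ex_intro (fun m => (mlead F <= m)%O) (mlead F) (lexx _).
elim/(well_founded_ind (@ltom_wf n)): m F AF le_m => m IH F AF le_m.
have [->//|nzF] := eqVneq F 0.
have [f ffs le_f] := fsP F (conj AF nzF); have [Af nzf] := fsA f ffs.
have {}le_f : (mlead f <= mlead F)%MM.
  by apply/mnm_lepP => i; rewrite !(mnm_nth 0%N) le_f.
pose c := (mleadc F / mleadc f) *: ('X_[mlead F - mlead f] : {mpoly K[n]}).
have nz : mleadc F / mleadc f != 0.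
  by rewrite mulf_neq0 ?invr_eq0 ?mleadc_eq0.
have nzX : 'X_[mlead F - mlead f] != 0 :> {mpoly K[n]}.
  by rewrite -msupp_eq0 msuppX.
have nzc : c != 0 by rewrite scaler_eq0 negb_or nz.
have lead_cf : mlead (c * f) = mlead F.
  by rewrite mleadM // /c mleadZ // mleadXm submK.
suff: M (F - c * f).
  by move=> MG; rewrite -(subrK (c * f) F); apply: MD => //; apply: MM; apply: Mfs.
have AG : A (F - c * f).
  by apply: AD => //; rewrite -mulN1r mulrA; apply: AM.
have [->//|nzG] := eqVneq (F - c * f) 0.
apply: (IH (mlead (F - c * f))) => //; apply: lt_le_trans le_m.
rewrite lt_neqAle; apply/andP; split.
  apply/eqP => E; move: nzG; rewrite -mleadc_eq0 E mcoeffB.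
  rewrite -{2}lead_cf mleadM // mleadcM /c mleadcZE mleadXm mcoeffX eqxx mulr1.
  by rewrite divfK ?subrr ?eqxx // mleadc_eq0.
apply: le_trans (mleadB_le _ _) _.
by rewrite lead_cf joinxx.
Qed.

(** The basis is taken in the ideal of all polynomials that vanish on [V], which
avoids picking finitely many equations out of the given ones. *)
Lemma affine_variety_finite (K : fieldType) (m : nat) (V : {ffun 'I_m -> K} -> Prop) :
  affine_variety V ->
  exists fs : seq {mpoly K[m]}, forall x, V x <-> forall f, f \in fs -> f.@[x] = 0.
Proof.
case=> S VS; pose A (f : {mpoly K[m]}) := forall x, V x -> f.@[x] = 0.
have Aid : left_ideal A.
  split=> [x _|f g Af Ag x Vx|a f Af x Vx]; first exact: meval0.
    by rewrite mevalD Af // Ag // addr0.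
  by rewrite mevalM Af // mulr0.
have [fs [fsA fsP]] := hilbert_basis Aid.
exists fs => x; split=> [Vx f /fsA|fx]; first exact.
apply/VS => F SF; have AF : A F by move=> y /VS; apply.
apply: (fsP F AF (fun f => f.@[x] = 0)) => //.
split=> [|f g fx0 gx0|a f fx0]; rewrite ?meval0 ?mevalD ?mevalM //.
  by rewrite fx0 gx0 addr0.
by rewrite fx0 mulr0.
Qed.

(** Continuity is automatic: the preimage of a zero set under a polynomial map is
the zero set of the substituted polynomials. *)
Lemma variety_iso_polynomial (K : fieldType) (m n : nat)
    (V : {ffun 'I_m -> K} -> Prop) (W : {ffun 'I_n -> K} -> Prop)
    (F : 'I_n -> {mpoly K[m]}) (G : 'I_m -> {mpoly K[n]}) :
  let f x := [ffun i => (F i).@[x]] in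
  let g y := [ffun i => (G i).@[y]] in
  (forall x, V x -> W (f x) /\ g (f x) = x) ->
  (forall y, W y -> V (g y) /\ f (g y) = y) ->
  variety_iso V W.
Proof.
move=> f g VW WV; exists f, g.
have cont (k l : nat) (U : {ffun 'I_k -> K} -> Prop) (H : 'I_l -> {mpoly K[k]}) :
    zariski_continuous_on U (fun x => [ffun i => (H i).@[x]]).
  move=> C [S CS].
  exists (zero_locus (fun P => exists2 Q, S Q & P = Q \mPo [tuple H i | i < l])).
  split=> [|x _]; first by eexists; move=> y; split; exact: id.
  have ev Q : (Q \mPo [tuple H i | i < l]).@[x] = Q.@[[ffun i => (H i).@[x]]].
    by rewrite comp_mpoly_meval; apply: meval_eq => i; rewrite tnth_mktuple ffunE.
  rewrite CS; split=> [Cx P [Q SQ ->]|Cx Q SQ]; first by rewrite ev Cx.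
  by rewrite -ev; apply: Cx; exists Q.
split; last by split=> i; [exists (F i)|exists (G i)] => x _; rewrite ffunE.
- by split=> [x /VW[]|y /WV[]].
- by split=> [x /VW[]|y /WV[]].
- by split; apply: cont.
Qed.

(** * Left ideals and path algebras *)

Section LeftIdeals.
Variable A : pzRingType.
Implicit Types (M G : A -> Prop).

Lemma generated_left_idealP G : left_ideal (generated_left_ideal G).
Proof.
split=> [M [M0 _ _] _ //|x y Gx Gy M Mid GM|a x Gx M Mid GM].
  by case: (Mid) => _ MD _; apply: MD; [apply: Gx|apply: Gy].
by case: (Mid) => _ _ MM; apply: MM; apply: Gx.
Qed.

Lemma left_ideal_sum M (J : finType) (F : J -> A) :
  left_ideal M -> (forall j, M (F j)) -> M (\sum_j F j).
Proof. by case=> M0 MD _ MF; elim/big_ind: _ => // j _; apply: MF. Qed.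

End LeftIdeals.

Section PathAlgebraBasics.
Variables (R : comNzRingType) (Q : quiver).
Implicit Types (x y : palg R Q) (q : qpath Q).

Lemma palg_ind (P : palg R Q -> Prop) :
  P 0 -> (forall x y, P x -> P y -> P (x + y)) ->
  (forall c q, P (c *: pbasis R q)) -> forall x, P x.
Proof. by move=> P0 PD PZ x; rewrite (palgE x); elim/big_ind: _. Qed.

Lemma palgZAr (c : R) x y : x * (c *: y) = c *: (x * y).
Proof.
elim/palg_ind: x => [|x x' IHx IHx'|d q]; first by rewrite !mul0r scaler0.
  by rewrite !mulrDl scalerDr IHx IHx'.
by rewrite -!scaler_mulAl -[pbasis R q * _]/(palg_mul _ _) palg_mulUZ !scalerA mulrC.
Qed.

Lemma left_idealZ (M : palg R Q -> Prop) (c : R) x : left_ideal M -> M x -> M (c *: x).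
Proof.
by case=> _ _ MM Mx; rewrite -[x]mul1r scaler_mulAl; apply: MM.
Qed.

(** The coefficient of a path of length 0 is a ring morphism: its kernel is a
maximal left ideal, and it describes how the algebra acts on paths that end in
a sink or start in a source. *)
Lemma pcoef_vpathM e x y :
  pcoef (vpath e) (x * y) = pcoef (vpath e) x * pcoef (vpath e) y.
Proof.
elim/palg_ind: x => [|x x' IHx IHx'|c q]; first by rewrite !(mul0r, pcoef0).
  by rewrite mulrDl !pcoefD mulrDl IHx IHx'.
elim/palg_ind: y => [|y y' IHy IHy'|d r]; first by rewrite !(mulr0, pcoef0).
  by rewrite mulrDr !pcoefD mulrDr IHy IHy'.
rewrite palgZAr -scaler_mulAl !pcoefZ mulrACA mulrA [d * c]mulrC; congr (_ * _).
rewrite pbasisM !pcoef_basis -natrM mulnb.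
have := pcompP q r; case: ifP => [/eqP E0 [s [-> s1 s2]]|ne ->] /=.
  rewrite pcoef_basis; congr (nat_of_bool _)%:R.
  apply/eqP/andP => [Es|[/eqP Eq /eqP Er]]; last first.
    by apply: qpath_inj; rewrite ?s1 ?s2 ?Eq ?Er.
  have /andP[/nilP r0 /nilP q0] : nilp (parrows r) && nilp (parrows q).
    by rewrite -cat_nilp -s2 Es.
  have Er : r = vpath e by apply: qpath_inj; rewrite // -s1 Es.
  rewrite Er eqxx; split=> //; apply/eqP/qpath_inj => //.
  by rewrite -E0 Er.
rewrite pcoef0; case: (q =P _) ne => [->|//]; case: (r =P _) => [->|//].
by rewrite /pend eqxx.
Qed.
End PathAlgebraBasics.

(** * The Jacobson radical when path lengths are bounded *)

Section Radical.
Variables (K : fieldType) (Q : quiver) (N : nat).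
Hypothesis plen_le : forall q : qpath Q, (plen q <= N)%N.
Implicit Types (x y : palg K Q) (q : qpath Q).

Lemma arrow_ideal_power_coef n x :
  arrow_ideal_power n x <-> forall q, (plen q < n)%N -> pcoef q x = 0.
Proof.
split=> xn q; first by apply: contraTeq; rewrite -psuppP -leqNgt => /xn.
by rewrite psuppP leqNgt; apply: contra => /xn ->.
Qed.

Lemma arrow_ideal_powerM n m x y :
  arrow_ideal_power n x -> arrow_ideal_power m y -> arrow_ideal_power (n + m) (x * y).
Proof.
move=> xn ym; apply/arrow_ideal_power_coef => s s_lt.
rewrite -[x * y]/(palg_mul x y) palg_mul.unlock pcoef_sum big_seq big1 // => q qx.
rewrite pcoef_sum big_seq big1 // => r ry; rewrite pcoefZ.
have := pcompP q r; case: ifP => [_ [t [-> _ t2]]|_ ->]; last by rewrite pcoef0 mulr0.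
rewrite pcoef_basis; case: eqP => [Et|]; last by rewrite mulr0.
move: s_lt; rewrite -Et /plen t2 size_cat ltnNge addnC.
by rewrite leq_add ?xn ?ym.
Qed.

Lemma arrow_ideal_power_gt x n : (N < n)%N -> arrow_ideal_power n x -> x = 0.
Proof.
move=> Nn /arrow_ideal_power_coef xn; apply/palgP => q.
by rewrite pcoef0 xn // (leq_ltn_trans (plen_le q)).
Qed.

(** If a maximal left ideal [M] misses the arrow [a], then 1 - z is in [M] for some
left multiple z of [a]. Modulo [M], z acts on the class of 1 as the identity,
while a power of z vanishes; so 1 is in [M]. *)
Lemma arrow_jacobson (I : palg K Q -> Prop) (a : qarrow Q) :
  jacobson_quotient I (pbasis K (apath a)).
Proof.
move=> M [Mid M1 Mmax] _; apply: NNPP => Ma.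
have [M0 MD MM] := Mid.
pose P x := exists2 m, M m & exists y, x = m + y * pbasis K (apath a).
have Pid : left_ideal P.
  split=> [|_ _ [m Mm [y ->]] [m' Mm' [y' ->]]|z _ [m Mm [y ->]]].
  - by exists 0 => //; exists 0; rewrite mul0r addr0.
  - by exists (m + m'); [apply: MD|exists (y + y'); rewrite mulrDl addrACA].
  - by exists (z * m); [apply: MM|exists (z * y); rewrite mulrDr mulrA].
have MP x : M x -> P x by move=> Mx; exists x => //; exists 0; rewrite mul0r addr0.
have [[m Mm [y E1]]|PM] := Mmax P Pid MP; last first.
  by apply: Ma; apply: PM; exists 0 => //; exists 1; rewrite mul1r add0r.
pose z := y * pbasis K (apath a).
  have z1 : arrow_ideal_power 1 z.
    rewrite -[1%N]add0n; apply: arrow_ideal_powerM => // q.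
    by move/(fsubsetP (psupp_basis_le K _)); rewrite inE => /eqP->.
  have zn n : arrow_ideal_power n (z ^+ n) /\ M (1 - z ^+ n).
    elim: n => [|n [IH1 IH2]]; first by rewrite expr0 subrr.
    rewrite exprS; split; first by rewrite -[n.+1]add1n; apply: arrow_ideal_powerM.
    have -> : 1 - z * z ^+ n = (1 - z) + z * (1 - z ^+ n).
      by rewrite mulrBr mulr1 addrA subrK.
    by apply: MD; [rewrite E1 addrK|apply: MM].
  have [/(arrow_ideal_power_gt (ltnSn N)) -> M1'] := zn N.+1.
by apply: M1; rewrite -[1]subr0.
Qed.

(** The kernels of the coefficients at the vertices are maximal left ideals, and they
contain [I]. *)
Lemma jacobson_arrow_ideal (I : palg K Q -> Prop) x :
  (forall y, I y -> arrow_ideal_power 1 y) ->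
  jacobson_quotient I x -> arrow_ideal_power 1 x.
Proof.
move=> I1 Jx; apply/arrow_ideal_power_coef => q.
rewrite ltnS leqn0 => /nilP q0.
have -> : q = vpath (pstart q) by apply: qpath_inj.
move: (pstart q) => {q q0} e; pose M y := pcoef (vpath e) y = 0.
have pcoef1 : pcoef (vpath e) (1 : palg K Q) = 1.
  rewrite -[1]/(palg_one K Q) pcoef_sum (bigD1 e) //= pcoef_basis eqxx big1 ?addr0 //.
  by move=> f fe; rewrite pcoef_basis; case: eqP => // -[E]; rewrite E eqxx in fe.
apply: (Jx M); last first.
  by move=> y /I1 /arrow_ideal_power_coef; apply.
split=> [||P Pid MP].
- split=> [|y z My Mz|y z Mz]; rewrite /M; first exact: pcoef0.
    by rewrite pcoefD My Mz addr0.
  by rewrite pcoef_vpathM Mz mulr0.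
- by rewrite /M pcoef1; apply/eqP/oner_neq0.
have [PM'|] := classic (forall y, P y -> M y); first by right.
move=> nPM; have [y nPy] := not_all_ex_not _ _ nPM.
have [Py /eqP nzy] := imply_to_and _ _ nPy; have [_ PD _] := Pid; left.
rewrite -(subrK ((pcoef (vpath e) y)^-1 *: y) 1); apply: PD; last first.
  exact: left_idealZ.
by apply: MP; rewrite /M -scaleN1r !(pcoefD, pcoefZ) pcoef1 mulVf // mulN1r subrr.
Qed.

Lemma jacobson_power_zeroS (I : palg K Q -> Prop) :
  I 0 -> (forall y, I y -> arrow_ideal_power 1 y) -> jacobson_power_zero I N.+1.
Proof.
move=> I0 I1 x Jx.
suff: arrow_ideal_power N.+1 (\prod_i x i).
  by move/(arrow_ideal_power_gt (ltnSn N)) ->.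
elim: N.+1 x Jx => [|n IH] x Jx //.
rewrite big_ord_recl; apply: (@arrow_ideal_powerM 1 n).
  exact: jacobson_arrow_ideal (Jx _).
by apply: IH => i; apply: Jx.
Qed.

End Radical.

(** * The ladder quiver *)

Section Ladder.
Variable T : nat.

Definition ladder_length : nat := T.*2.+2.
Local Notation N := ladder_length.

Definition ladder_step (i j : nat) : bool :=
  (j == i.+1) || [&& ~~ odd i, (i < T.*2)%N & j == i.+2].

Definition ladder_arrow : finType :=
  {ij : 'I_N.+1 * 'I_N.+1 | ladder_step ij.1 ij.2}.

Definition ladder : quiver :=
  Quiver (fun a : ladder_arrow => (val a).1) (fun a : ladder_arrow => (val a).2).

#[local] Arguments qsrc : simpl never.
#[local] Arguments qtgt : simpl never.

Implicit Types (a : qarrow ladder) (q : qpath ladder) (t : 'I_T).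

Lemma ladder_no_double_arrows : no_double_arrows ladder.
Proof. by move=> a b Es Et; apply: val_inj; apply: injective_projections. Qed.

(** Arrows increase the numbering of the vertices; this gives acyclicity and bounds
the lengths of paths. *)
Lemma ladder_plen q : (pstart q + plen q <= pend q)%N.
Proof.
rewrite /pend /plen; move: (walk_path q); elim: (parrows q) (pstart q) => [|a s IH] e /=.
  by rewrite addn0.
case/andP=> /eqP <- /IH; apply: leq_trans; rewrite addnS -addSn leq_add2r.
by case: a => [[i j] /=]; rewrite /ladder_step /qsrc /qtgt /=; lia.
Qed.

Lemma ladder_plen_le q : (plen q <= N)%N.
Proof.
by have := ladder_plen q; have := ltn_ord (pend q : 'I_N.+1); lia.
Qed.

Lemma ladder_acyclic : acyclic ladder.
Proof. by move=> q Eq; have := ladder_plen q; rewrite Eq; lia. Qed.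

(** The default value, the arrow 0 -> 1, is taken only when there is no arrow from
[i] to [j]. *)
Definition larrow (i j : nat) : qarrow ladder :=
  insubd (Sub (ord0, lift ord0 ord0) isT : ladder_arrow) (inord i, inord j).

Lemma larrowE i j : ladder_step i j -> (j <= N)%N ->
  (qsrc (larrow i j) = inord i) * (qtgt (larrow i j) = inord j).
Proof.
move=> ij jN; have iN : (i <= N)%N by move: ij; rewrite /ladder_step; lia.
rewrite /qsrc /qtgt /larrow /= val_insubd /= !inordK ?ltnS // ij //.
Qed.

Lemma ladder_step_src a : ladder_step (qsrc a) (qtgt a).
Proof. by case: a => [[i j]]. Qed.

Lemma larrow_val a : larrow (qsrc a) (qtgt a) = a.
Proof.
have st := ladder_step_src a.
have jN : (qtgt a <= N)%N by rewrite -ltnS ltn_ord.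
apply: ladder_no_double_arrows; rewrite (larrowE st jN); exact: inord_val.
Qed.

Lemma spath_walk k : (k <= N)%N ->
  walk (Q := ladder) ord0 (mkseq (fun i => larrow i i.+1) k) /\
  last ord0 [seq qtgt a | a <- mkseq (fun i => larrow i i.+1) k] = inord k.
Proof.
elim: k => [|k IH] kN; first by split=> //; apply: val_inj; rewrite /= inordK.
have [w1 w2] := IH (ltnW kN); have st : ladder_step k k.+1 by rewrite /ladder_step eqxx.
rewrite mkseqS -cats1 walk_cat map_cat last_cat w1 w2 /= (larrowE st) //.
by rewrite (larrowE st kN) eqxx.
Qed.

(** The path 0 -> 1 -> ... -> k; these are the right subpaths of [lpath]. *)
Definition spath (k : nat) : qpath ladder :=
  insubd (vpath (Q := ladder) ord0) (ord0, mkseq (fun i => larrow i i.+1) k).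

Lemma val_spath k : (k <= N)%N ->
  val (spath k) = (ord0, mkseq (fun i => larrow i i.+1) k).
Proof. by move=> kN; rewrite val_insubd /= (spath_walk kN).1. Qed.

Lemma pstart_spath k : (k <= N)%N -> pstart (spath k) = ord0.
Proof. by move=> kN; rewrite /pstart val_spath. Qed.

Lemma parrows_spath k : (k <= N)%N ->
  parrows (spath k) = mkseq (fun i => larrow i i.+1) k.
Proof. by move=> kN; rewrite /parrows val_spath. Qed.

Lemma pend_spath k : (k <= N)%N -> pend (spath k) = inord k.
Proof.
by move=> kN; rewrite /pend pstart_spath // parrows_spath // (spath_walk kN).2.
Qed.

Lemma plen_spath k : (k <= N)%N -> plen (spath k) = k.
Proof. by move=> kN; rewrite /plen parrows_spath // size_mkseq. Qed.

Lemma spathS k : (k < N)%N -> pcomp (apath (larrow k k.+1)) (spath k) = Some (spath k.+1).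
Proof.
move=> kN; have := pcompP (apath (larrow k k.+1)) (spath k).
have st : ladder_step k k.+1 by rewrite /ladder_step eqxx.
rewrite (pend_spath (ltnW kN)) -[pstart (apath _)]/(qsrc (larrow k k.+1)).
rewrite (larrowE st kN) eqxx.
case=> r [-> r1 r2]; congr Some; apply: qpath_inj.
  by rewrite r1 !pstart_spath // ltnW.
by rewrite r2 !parrows_spath ?(ltnW kN) // mkseqS -cats1.
Qed.

Definition lpath : qpath ladder := spath N.

Lemma plen_lpath : plen lpath = N. Proof. exact: plen_spath. Qed.

Lemma rsub_lpath (k : 'I_(plen lpath).+1) : rsub k = spath k.
Proof.
have kN : (k <= N)%N by rewrite -plen_lpath -ltnS ltn_ord.
apply: qpath_inj; first by rewrite [LHS]pstart_spath ?pstart_spath.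
rewrite -[LHS]/(take k (parrows (spath N))) !parrows_spath //.
by rewrite /mkseq -map_take take_iota (minn_idPl kN).
Qed.

Lemma pend_rsub_lpath (k : 'I_(plen lpath).+1) : pend (rsub k) = k :> nat.
Proof.
have kN : (k <= N)%N by rewrite -plen_lpath -ltnS ltn_ord.
by rewrite rsub_lpath pend_spath // inordK.
Qed.

Definition darrow t : qarrow ladder := larrow t.*2 t.*2.+2.

Lemma darrow_step t : ladder_step t.*2 t.*2.+2 /\ (t.*2.+2 <= N)%N.
Proof. by have := ltn_ord t; rewrite /ladder_step /ladder_length; lia. Qed.

Lemma qsrc_darrow t : qsrc (darrow t) = inord t.*2.
Proof. by have [st tN] := darrow_step t; rewrite (larrowE st tN). Qed.

Lemma qtgt_darrow t : qtgt (darrow t) = inord t.*2.+2.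
Proof. by have [st tN] := darrow_step t; rewrite (larrowE st tN). Qed.

Lemma darrow_inj : injective darrow.
Proof.
move=> t t' /(congr1 (fun a => nat_of_ord (qsrc a))); rewrite !qsrc_darrow.
have [_ tN] := darrow_step t; have [_ tN'] := darrow_step t'.
by rewrite !inordK ?ltnS; [move=> E; apply: val_inj => /=; lia|lia|lia].
Qed.

Definition dtriple t : qarrow ladder * 'I_(plen lpath).+1 * 'I_(plen lpath).+1 :=
  (darrow t, inord t.*2, inord t.*2.+2).

Lemma pcomp_apath a q : pend q = qsrc a ->
  exists r, [/\ pcomp (apath a) q = Some r, pstart r = pstart q
              & parrows r = rcons (parrows q) a].
Proof. by move=> Eq; have := pcompP (apath a) q; rewrite Eq eqxx -cats1. Qed.

Lemma is_dvar_dtriple t : is_dvar (dtriple t).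
Proof.
have [_ tN] := darrow_step t.
have u_val : (inord t.*2 : 'I_(plen lpath).+1) = t.*2 :> nat.
  by rewrite inordK // ltnS plen_lpath; lia.
have v_val : (inord t.*2.+2 : 'I_(plen lpath).+1) = t.*2.+2 :> nat.
  by rewrite inordK // ltnS plen_lpath; lia.
have v_end : pend (rsub (inord t.*2.+2 : 'I_(plen lpath).+1)) = qtgt (darrow t).
  by apply: ord_inj; rewrite pend_rsub_lpath v_val qtgt_darrow inordK // ltnS.
have u_end : pend (rsub (inord t.*2 : 'I_(plen lpath).+1)) = qsrc (darrow t).
  by apply: ord_inj; rewrite pend_rsub_lpath u_val qsrc_darrow inordK // ltnS; lia.
have [r [rE r1 r2]] := pcomp_apath u_end.
rewrite /is_dvar /= u_val v_val v_end eqxx ltnW //= andbT /detour rE /=.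
apply/andP; split; last first.
  by apply/existsP; exists (inord t.*2.+2); rewrite u_val v_val v_end ltnW /=.
apply/forallP => v; apply/eqP => -[Er].
have := congr1 (@pend _) Er => /(congr1 (@nat_of_ord _)).
rewrite pend_rsub_lpath {1}/pend r2 map_rcons last_rcons qtgt_darrow inordK //.
move=> Ev; have := congr1 (@plen _) Er.
by rewrite plen_rsub /plen r2 size_rcons -/(plen _) plen_rsub u_val -Ev; lia.
Qed.

Definition ldvar t : dvar lpath := Sub (dtriple t) (is_dvar_dtriple t).

(** An arrow that continues [lpath] is not a detour, so a detour is a shortcut; and
since the vertices of [lpath] are distinct, the shortcut determines both [u] and
the unique [v]. *)
Lemma ldvar_surj (d : dvar lpath) : exists t, d = ldvar t.
Proof.
suff [t E] : exists t, val d = dtriple t by exists t; apply: val_inj.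
case: d => [[[a u] v] dP] /=; move: dP; rewrite /is_dvar /=.
case/and3P=> /and3P[au /forallP nv _] uv /eqP v_end.
have u_end : pend (rsub u) = qsrc a.
  have := pcompP (apath a) (rsub u); case: ifP => [/eqP //|_ E].
  by rewrite E eqxx in au.
have u_src : qsrc a = u :> nat by rewrite -u_end pend_rsub_lpath.
have v_tgt : qtgt a = v :> nat by rewrite -v_end pend_rsub_lpath.
have := ladder_step_src a; rewrite /ladder_step u_src v_tgt.
case/orP=> [/eqP Ev|/and3P[eu uT /eqP Ev]].
  have := nv v; rewrite !rsub_lpath -[a]larrow_val u_src v_tgt Ev spathS ?eqxx //.
  by rewrite -Ev -plen_lpath -ltnS ltn_ord.
have tT : (u./2 < T)%N by move: uT eu; lia.
have Eu : u./2.*2 = u by move: eu; lia.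
exists (Ordinal tT); rewrite /dtriple /darrow /= Eu -Ev.
by rewrite !inord_val -{1}u_src -{1}v_tgt larrow_val.
Qed.

Lemma ldvar_inj : injective ldvar.
Proof. by move=> t t' /(congr1 (fun d => (val d).1.1)) /darrow_inj. Qed.

End Ladder.

(** * Normal forms of paths *)

Section NormalForms.
Variables (K : fieldType) (T : nat).
Local Notation N := (ladder_length T).
Local Notation P := (lpath T).
Local Notation KX := {mpoly K[nvar P]}.
Local Notation Lp := (@Lp K (ladder T) P).
Implicit Types (S : {set 'I_T}) (t : 'I_T) (q r v w : qpath (ladder T)).

Definition lvar t : 'I_(nvar P) := enum_rank (ldvar t).

Lemma lvar_bij : bijective lvar.
Proof.
apply: bij_comp; first by exists enum_val; [apply: enum_rankK|apply: enum_valK].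
apply: inj_card_bij; first exact: ldvar_inj.
rewrite -(card_codom (@ldvar_inj T)); apply: subset_leq_card.
by apply/subsetP => d _; have [t ->] := ldvar_surj d; apply: codom_f.
Qed.

Lemma Lp_ideal : left_ideal Lp. Proof. exact: generated_left_idealP. Qed.

(** The sum in the generator of [Lp] attached to a shortcut has a single term. *)
Lemma Lp_detour t :
  Lp (pbasis KX (apath (darrow t)) * pbasis KX (spath T t.*2)
      - 'X_(lvar t) *: pbasis KX (spath T t.*2.+2)).
Proof.
have [_ tN] := darrow_step t.
move=> M _; apply; right; exists (darrow t), (inord t.*2).
split; first by have /and3P[] := is_dvar_dtriple t.
rewrite (big_pred1 (ldvar t)) => [|d]; last first.
  have [s ->] := ldvar_surj d; rewrite -[val _]/(dtriple s) /= xpair_eqE.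
  rewrite (inj_eq (@darrow_inj T)) (inj_eq (@ldvar_inj T)).
  by case: eqP => [->|]; rewrite ?eqxx.
by rewrite !rsub_lpath /= !inordK // ltnS plen_lpath // ltnW // ltnW.
Qed.

(** Normal forms are computed arrow by arrow, as [Lp] is a left ideal and the
arrow is multiplied on the left. *)
Lemma Lp_extend a (c d : KX) q r v w :
  pcomp (apath a) q = Some r ->
  Lp (pbasis KX q - c *: pbasis KX v) ->
  Lp (pbasis KX (apath a) * pbasis KX v - d *: pbasis KX w) ->
  Lp (pbasis KX r - (c * d) *: pbasis KX w).
Proof.
move=> qr Lq Lv; have [_ LD LM] := Lp_ideal.
have -> : pbasis KX r - (c * d) *: pbasis KX w =
    pbasis KX (apath a) * (pbasis KX q - c *: pbasis KX v) +
    c *: (pbasis KX (apath a) * pbasis KX v - d *: pbasis KX w).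
  by rewrite mulrBr (pbasisM _ _ q) qr /= palgZAr scalerBr scalerA addrA subrK.
by apply: LD; [apply: LM|apply: left_idealZ Lp_ideal Lv].
Qed.

Definition segment_multiple q k (c : KX) :=
  [/\ pstart q = ord0, pend q = inord k & Lp (pbasis KX q - c *: pbasis KX (spath T k))].

Lemma segment_multipleS q k (c : KX) : (k < N)%N -> segment_multiple q k c ->
  exists2 r, plen r = (plen q).+1 & segment_multiple r k.+1 c.
Proof.
move=> kN [q0 qk Lq]; have st : ladder_step T k k.+1 by rewrite /ladder_step eqxx.
have [|r [qr r1 r2]] := @pcomp_apath T (larrow T k k.+1) q.
  by rewrite qk (larrowE st).
exists r; first by rewrite /plen r2 size_rcons.
split; first by rewrite r1.
  by rewrite /pend r2 map_rcons last_rcons (larrowE st).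
rewrite -[c]mulr1; apply: Lp_extend qr Lq _.
by rewrite pbasisM spathS //= scale1r subrr; have [] := Lp_ideal.
Qed.

Lemma segment_multiple_darrow q t (c : KX) : segment_multiple q t.*2 c ->
  exists r, segment_multiple r t.*2.+2 (c * 'X_(lvar t)).
Proof.
move=> [q0 qk Lq]; have [|r [qr r1 r2]] := @pcomp_apath T (darrow t) q.
  by rewrite qk qsrc_darrow.
exists r; split; first by rewrite r1.
  by rewrite /pend r2 map_rcons last_rcons qtgt_darrow.
by apply: Lp_extend qr Lq _; apply: Lp_detour.
Qed.

(** The path goes through the pieces 2t -> 2t+1 -> 2t+2 in order, replacing
those with t in [S] by the shortcut. *)
Lemma monomial_path S :
  exists q, (2 <= plen q)%N /\ segment_multiple q N (\prod_(t in S) 'X_(lvar t)).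
Proof.
have prefix k : (k <= T)%N ->
    exists q, segment_multiple q k.*2 (\prod_(t | (t \in S) && (t < k)%N) 'X_(lvar t)).
  elim: k => [|k IH] kT.
    exists (spath T 0); rewrite big_pred0 => [|t]; last by rewrite andbF.
    split; rewrite ?pstart_spath ?pend_spath // scale1r subrr.
    by have [] := Lp_ideal.
  have [q qk] := IH (ltnW kT); pose t := Ordinal kT.
  have [tS|tS] := boolP (t \in S).
    have [r rk] := @segment_multiple_darrow q t _ qk; exists r.
    rewrite (bigD1 t) /= ?tS ?leqnn // mulrC doubleS.
    congr (segment_multiple r _ (_ * _)): rk; apply: eq_bigl => s.
    by rewrite -andbA ltnS [(s <= k)%N]leq_eqVlt -val_eqE /=; case: ltngtP.
  have kN : (k.*2.+1 < N)%N by rewrite /ladder_length; lia.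
  have [r _ rk] := segment_multipleS (ltnW kN) qk.
  have [r' _ r'k] := segment_multipleS kN rk.
  exists r'; rewrite doubleS; congr (segment_multiple r' _ _): r'k; apply: eq_bigl => s.
  rewrite ltnS [(s <= k)%N]leq_eqVlt; case: (s =P k :> nat) => [sk|] //=.
  by rewrite (_ : s = t) ?(negPf tS) //; apply: val_inj.
have [q qT] := prefix T (leqnn T).
(* The two arrows behind all shortcuts bring the length to at least 2. *)
have [r r1 rk] := segment_multipleS (leqW (ltnSn T.*2)) qT.
have [r' r2 r'k] := segment_multipleS (ltnSn T.*2.+1) rk.
exists r'; split; first by rewrite r2 r1.
by congr (segment_multiple r' _ _): r'k; apply: eq_bigl => s; rewrite ltn_ord andbT.
Qed.

Lemma const_ext_coef q (z : palg K (ladder T)) :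
  pcoef q (const_ext P z) = (pcoef q z)%:MP.
Proof.
rewrite {2}(palgE z) !pcoef_sum raddf_sum /=; apply: eq_bigr => r _.
by rewrite !pcoefZ !pcoef_basis mpolyCM; case: eqP; rewrite ?mulr1 ?mulr0.
Qed.

End NormalForms.

(** * The algebra defined by multilinear equations *)

Section Relations.
Variables (K : fieldType) (T : nat) (J : finType) (g : J -> {set 'I_T} -> K).
Local Notation N := (ladder_length T).
Local Notation P := (lpath T).
Local Notation KX := {mpoly K[nvar P]}.
Local Notation KQ := (palg K (ladder T)).
Variable q : {set 'I_T} -> qpath (ladder T).
Hypothesis q_long : forall S, (2 <= plen (q S))%N.
Hypothesis q_value : forall S, segment_multiple (q S) N (\prod_(t in S) 'X_(lvar t) : KX).

Definition relation (j : J) : KQ := \sum_(S : {set 'I_T}) g j S *: pbasis K (q S).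

(** A linear span; it is a two-sided ideal because the paths [q S] run from a source
to a sink. *)
Definition relation_ideal (z : KQ) : Prop :=
  exists c : J -> K, z = \sum_j c j *: relation j.

Lemma relation_ideal_rel j : relation_ideal (relation j).
Proof.
exists (fun i => (i == j)%:R); rewrite (bigD1 j) //= eqxx scale1r big1 ?addr0 // => i.
by move=> /negPf->; rewrite scale0r.
Qed.

Lemma relation_ideal_ind (A : KQ -> Prop) :
  A 0 -> (forall x y, A x -> A y -> A (x + y)) ->
  (forall c S, A (c *: pbasis K (q S))) -> forall z, relation_ideal z -> A z.
Proof.
move=> A0 AD AZ _ [c ->]; elim/big_ind: _ => // j _.
by rewrite scaler_sumr; elim/big_ind: _ => // S _; rewrite scalerA.
Qed.

Lemma relation_ideal_supp z r : relation_ideal z -> r \in psupp z ->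
  [/\ pstart r = ord0, pend r = inord N & (2 <= plen r)%N].
Proof.
rewrite psuppP => Iz; pose A (z : KQ) := pcoef r z != 0 ->
  [/\ pstart r = ord0, pend r = inord N & (2 <= plen r)%N].
apply: (relation_ideal_ind (A := A)) Iz; rewrite /A.
- by rewrite pcoef0 eqxx.
- move=> x y IHx IHy; rewrite pcoefD.
  by have [->|/IHx //] := eqVneq (pcoef r x) 0; rewrite add0r.
- move=> c S; rewrite pcoefZ pcoef_basis; case: (q S =P r) => [<- _|]; last by rewrite mulr0 eqxx.
  by have [] := q_value S.
Qed.

(** The only path that can be attached to [q S] at its end is the trivial one. *)
Lemma relation_idealMl x z : relation_ideal z ->
  x * z = pcoef (vpath (Q := ladder T) (inord N)) x *: z.
Proof.
move=> Iz; apply: (relation_ideal_ind (A := fun z => _ * z = _ *: z)) Iz.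
- by rewrite mulr0 scaler0.
- by move=> y y' E E'; rewrite mulrDr E E' scalerDr.
move=> c S; rewrite palgZAr [RHS]scalerA mulrC -scalerA; congr (_ *: _).
elim/palg_ind: x => [|x y IHx IHy|d r]; first by rewrite mul0r pcoef0 scale0r.
  by rewrite mulrDl IHx IHy pcoefD scalerDl.
rewrite -scaler_mulAl pbasisM pcoefZ -scalerA pcoef_basis; congr (_ *: _).
have [_ qN _] := q_value S; case: eqP => [->|ne].
  by rewrite pcomp1p qN eqxx scale1r.
have := pcompP r (q S); rewrite qN; case: ifP => [/eqP Er _|_ ->]; last by rewrite scale0r.
case: ne; have := ladder_plen r; have := ltn_ord (pend r : 'I_N.+1).
rewrite -Er inordK // => rN r0; apply: qpath_inj; rewrite -?Er //.
by apply/nilP; rewrite /nilp -/(plen r); move: rN r0; lia.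
Qed.

Lemma relation_idealMr x z : relation_ideal z ->
  z * x = pcoef (vpath (Q := ladder T) ord0) x *: z.
Proof.
move=> Iz; apply: (relation_ideal_ind (A := fun z => z * _ = _ *: z)) Iz.
- by rewrite mul0r scaler0.
- by move=> y y' E E'; rewrite mulrDl E E' scalerDr.
move=> c S; rewrite -scaler_mulAl [RHS]scalerA mulrC -scalerA; congr (_ *: _).
elim/palg_ind: x => [|x y IHx IHy|d r]; first by rewrite mulr0 pcoef0 scale0r.
  by rewrite mulrDr IHx IHy pcoefD scalerDl.
rewrite palgZAr pbasisM pcoefZ -scalerA pcoef_basis; congr (_ *: _).
have [q0 _ _] := q_value S; case: eqP => [->|ne].
  by rewrite pcompp1 q0 eqxx scale1r.
have := pcompP (q S) r; rewrite q0; case: ifP => [/eqP Er _|_ ->]; last by rewrite scale0r.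
case: ne; have := ladder_plen r; rewrite Er /= => r0.
have r00 : pstart r = ord0 by apply: ord_inj => /=; move: r0; lia.
by apply: qpath_inj => //; apply/nilP; rewrite /nilp -/(plen r); move: r0; lia.
Qed.

Lemma relation_ideal_admissible : admissible relation_ideal.
Proof.
have I0 : relation_ideal 0.
  by exists (fun=> 0); rewrite big1 // => j _; rewrite scale0r.
have IZ c z : relation_ideal z -> relation_ideal (c *: z).
  case=> d ->; exists (fun j => c * d j); rewrite scaler_sumr.
  by apply: eq_bigr => j _; rewrite scalerA.
split.
- split=> [|x z Iz]; last by rewrite relation_idealMr //; apply: IZ.
  split=> [//|x y [c ->] [d ->]|x z Iz]; last by rewrite relation_idealMl //; apply: IZ.
  exists (fun j => c j + d j); rewrite -big_split; apply: eq_bigr => j _ /=.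
  by rewrite scalerDl.
- by move=> z Iz r /(relation_ideal_supp Iz)[].
- by exists N.+1 => z /(arrow_ideal_power_gt (@ladder_plen_le T) (ltnSn N)) ->.
Qed.

(** The factors are numbered from the last arrow down to the first; the factor
[spath T 0] accounts for the empty product, which is the sum of all vertices. *)
Lemma prod_arrows n : (n <= N)%N ->
  (\prod_(i < n) pbasis K (apath (larrow T (n - i.+1) (n - i.+1).+1))) *
    pbasis K (spath T 0) = pbasis K (spath T n).
Proof.
elim: n => [|n IH] nN; first by rewrite big_ord0 mul1r.
rewrite big_ord_recl subn1 -[n.+1.-1]/n -mulrA.
under eq_bigr do rewrite lift0 subSS.
by rewrite IH 1?ltnW // pbasisM spathS.
Qed.

(** A proper initial segment of [lpath] is a product of arrows, which lie in the
radical, and it does not end in the sink; so it is not in the ideal. *)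
Lemma loewy_length_ge n : jacobson_power_zero relation_ideal n -> (N <= n)%N.
Proof.
move=> Jn; rewrite leqNgt; apply/negP => nN.
have /Jn I1 i : jacobson_quotient relation_ideal
    (pbasis K (apath (larrow T (n - i.+1) (n - i.+1).+1))).
  exact: arrow_jacobson (@ladder_plen_le T) _ _.
have [[[_ _ _] IM] _ _] := relation_ideal_admissible.
have := IM (pbasis K (spath T 0)) _ I1; rewrite prod_arrows 1?ltnW // => I2.
have : spath T n \in psupp (pbasis K (spath T n)).
  by rewrite psuppP pcoef_basis eqxx oner_neq0.
case/(relation_ideal_supp I2) => _ /(congr1 (@nat_of_ord _)) + _.
by rewrite pend_spath 1?ltnW // !inordK // 1?ltnW // => E; move: nN; rewrite E ltnn.
Qed.

(** Whether the length is N or N + 1 depends on whether [lpath] is in the ideal; in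
both cases no path is longer than the Loewy length. *)
Lemma loewy_length_exists :
  exists2 L, loewy_length relation_ideal L & (N <= L)%N.
Proof.
have [[[I0 _ _] _] I2 _] := relation_ideal_admissible.
have JS : jacobson_power_zero relation_ideal N.+1.
  apply: jacobson_power_zeroS (@ladder_plen_le T) _ I0 _ => y /I2 y2 r /y2.
  exact: ltnW.
have [JN|nJN] := classic (jacobson_power_zero relation_ideal N).
  by exists N => //; split=> // n /loewy_length_ge.
exists N.+1 => //; split=> // n Jn; have := loewy_length_ge Jn.
by rewrite leq_eqVlt => /orP[/eqP En|//]; case: nJN; rewrite En.
Qed.

Definition relation_poly (j : J) : KX :=
  \sum_(S : {set 'I_T}) (g j S)%:MP * \prod_(t in S) 'X_(lvar t).

(** Relations end in the sink, so only the coefficient of the full path [lpath] can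
be non-zero. *)
Definition relation_tau (j : J) (k : 'I_(plen P).+1) : KX :=
  if k == N :> nat then relation_poly j else 0.

Lemma normal_form_relation j : normal_form (relation j) (relation_tau j).
Proof.
have kN : (N < (plen P).+1)%N by rewrite plen_lpath.
rewrite /normal_form (bigD1 (Ordinal kN)) //= big1 => [|k]; last first.
  rewrite -val_eqE /= /relation_tau => /negPf->; exact: scale0r.
rewrite addr0 /relation_tau /= eqxx rsub_lpath /=.
have -> : const_ext P (relation j) = \sum_S (g j S)%:MP *: pbasis KX (q S).
  apply/palgP => r; rewrite const_ext_coef !pcoef_sum raddf_sum /=.
  apply: eq_bigr => S _; rewrite !pcoefZ !pcoef_basis mpolyCM.
  by case: eqP; rewrite ?mulr1 ?mulr0.
rewrite /relation_poly scaler_suml -sumrB.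
apply: left_ideal_sum (@Lp_ideal K T) _ => S.
rewrite -scalerA -scalerBr; apply: left_idealZ (@Lp_ideal K T) _.
by have [] := q_value S.
Qed.

Lemma is_Vp_relation_ideal L : (N <= L)%N ->
  is_Vp P relation_ideal L (fun y => forall j, (relation_poly j).@[y] = 0).
Proof.
move=> NL; exists #|J|, (relation \o enum_val), (relation_tau \o enum_val); split.
- split=> [i|z [[c ->] _]].
    split; first exact: relation_ideal_rel.
    by move=> r _; apply: leq_trans NL; apply: ladder_plen_le.
  exists (c \o enum_val); exact: reindex (onW_bij _ (enum_val_bij J)).
- by move=> i; apply: normal_form_relation.
move=> y; have kN : (N < (plen P).+1)%N by rewrite plen_lpath.
split=> [Wy F [i [k ->]]|Wy j].
  by rewrite /relation_tau /=; case: ifP; rewrite ?meval0.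
apply: Wy; exists (enum_rank j), (Ordinal kN).
by rewrite /relation_tau /= enum_rankK eqxx.
Qed.

Lemma meval_relation_poly j (y : 'I_(nvar P) -> K) :
  (relation_poly j).@[y] = \sum_(S : {set 'I_T}) g j S * \prod_(t in S) y (lvar t).
Proof.
rewrite raddf_sum /=; apply: eq_bigr => S _; rewrite mevalM mevalC rmorph_prod /=.
by congr (_ * _); apply: eq_bigr => t _; rewrite mevalXU.
Qed.

End Relations.

(** * From arbitrary to multilinear equations *)

(** The coordinates of [V_p] are the shortcuts of the ladder, by [lvar_bij]. *)
Theorem multilinear_realization (K : fieldType) (T : nat) (J : finType)
    (g : J -> {set 'I_T} -> K) :
  exists (I : palg K (ladder T) -> Prop) (L : nat),
    [/\ admissible I, loewy_length I L
      & is_Vp (lpath T) I L (fun y => forall j,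
          \sum_(S : {set 'I_T}) g j S * \prod_(t in S) y (lvar t) = 0)].
Proof.
have [q qP] := fin_all_exists (fun S => @monomial_path K T S).
have q_value S := (qP S).2; have q_long S := (qP S).1.
have [L LL NL] := loewy_length_exists g q_long q_value.
exists (relation_ideal g q), L; split=> //.
  exact: relation_ideal_admissible q_long q_value.
have [s [t [tau [sp nf W]]]] := is_Vp_relation_ideal g q_value NL.
exists s, t, tau; split=> // y; rewrite -W.
by split=> Wy j; have := Wy j; rewrite meval_relation_poly.
Qed.

Section Polarization.
Variables (K : fieldType) (m D : nat).

Definition copies : finType := ('I_m * 'I_D)%type.
Local Notation T := #|copies|.

Definition original (t : 'I_T) : 'I_m := (enum_val t).1.

(** The set of copies whose product specializes to [M] when all copies of a variable
are identified: the first [M v] copies of each variable [v]. *)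
Definition monomial_copies (M : 'X_{1..m}) : {set 'I_T} :=
  [set t : 'I_T | ((enum_val t : copies).2 < M (original t))%N].

Lemma prod_monomial_copies (x : 'I_m -> K) (M : 'X_{1..m}) :
  (forall v, (M v <= D)%N) ->
  \prod_(t in monomial_copies M) x (original t) = \prod_v x v ^+ M v.
Proof.
move=> MD; transitivity (\prod_(c : copies | (c.2 < M c.1)%N) x c.1).
  rewrite [RHS](reindex _ (onW_bij _ (enum_val_bij copies))) /=.
  by apply: eq_bigl => t; rewrite inE.
rewrite -(pair_big_dep predT (fun v (d : 'I_D) => (d < M v)%N) (fun v _ => x v)) /=.
apply: eq_bigr => v _.
by rewrite -(big_ord_widen _ (fun=> x v) (MD v)) prodr_const card_ord.
Qed.

(** Several monomials of [f] may use the same copies only if an exponent exceeds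
[D]; summing over them avoids a case distinction. *)
Definition polar_coef (f : {mpoly K[m]}) (S : {set 'I_T}) : K :=
  \sum_(M <- msupp f | monomial_copies M == S) f@_M.

Lemma polar_coefE (f : {mpoly K[m]}) (x : 'I_m -> K) : (msize f <= D.+1)%N ->
  \sum_(S : {set 'I_T}) polar_coef f S * \prod_(t in S) x (original t) = f.@[x].
Proof.
move=> fD; rewrite mevalE.
under eq_bigr do rewrite mulr_suml big_mkcond.
rewrite exchange_big /= big_seq [RHS]big_seq; apply: eq_bigr => M fM.
rewrite -big_mkcond (big_pred1 (monomial_copies M)) => [|S]; last by rewrite eq_sym.
rewrite prod_monomial_copies // => v.
have := msize_mdeg_lt fM; move/leq_trans/(_ fD); rewrite ltnS; apply: leq_trans.
by rewrite mdegE (bigD1 v) //= leq_addr.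
Qed.

End Polarization.

Theorem theoremG (K : fieldType) (m : nat) (V : {ffun 'I_m -> K} -> Prop) :
  affine_variety V ->
  exists (Q : quiver) (I : palg K Q -> Prop) (L : nat) (p : qpath Q)
         (Vp : {ffun 'I_(nvar p) -> K} -> Prop),
    (admissible I /\ loewy_length I L /\ is_Vp p I L Vp /\ variety_iso V Vp) /\
    (acyclic Q /\ no_double_arrows Q).
Proof.
move=> /affine_variety_finite[fs Vfs].
(* Without the successor there would be no copy to serve as [rep] when all
   entries of [fs] are 0. *)
pose D := (\max_(f <- fs) msize f).+1; pose T := #|copies m D|.
pose rep (v : 'I_m) : 'I_T := enum_rank ((v, ord0) : copies m D).
have repK v : original (rep v) = v by rewrite /original enum_rankK.
(* The polynomials themselves, and the equations that identify the copies. *)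
pose g (j : 'I_(size fs) + 'I_T) (S : {set 'I_T}) : K :=
  match j with
  | inl i => polar_coef (D := D) (tnth (in_tuple fs) i) S
  | inr t => (S == [set t])%:R - (S == [set rep (original t)])%:R
  end.
have [I [L [Iadm LL IVp]]] := multilinear_realization g.
exists (ladder T), I, L, (lpath T); eexists; split; last first.
  by split; [apply: ladder_acyclic|apply: ladder_no_double_arrows].
do ![split; eauto].
have sum1 (c : {set 'I_T} -> K) S0 : \sum_S (S == S0)%:R * c S = c S0.
  rewrite (bigD1 S0) //= eqxx mul1r big1 ?addr0 // => S /negPf->; exact: mul0r.
have g_copy (z : 'I_T -> K) t :
    \sum_S g (inr t) S * \prod_(s in S) z s = z t - z (rep (original t)).
  rewrite /g; under eq_bigr do rewrite mulrBl.
  by rewrite sumrB !sum1 !big_set1.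
have g_poly (z : 'I_T -> K) x i : (forall t, z t = x (original t)) ->
    \sum_S g (inl i) S * \prod_(s in S) z s = (tnth (in_tuple fs) i).@[x].
  move=> zx; rewrite -(@polar_coefE _ _ D).
    by apply: eq_bigr => S _; congr (_ * _); apply: eq_bigr => s _.
  do 2!apply: leqW; apply: (@leq_bigmax_seq _ _ xpredT (fun f => msize f)) => //.
  exact: mem_tnth.
have [vt lvarK vtK] := lvar_bij T.
apply: (variety_iso_polynomial (F := fun i => 'X_(original (vt i)))
          (G := fun v => 'X_(lvar (rep v)))) => [x Vx|y Wy].
  split=> [[i|t]|].
  - rewrite (g_poly _ x) => [|t]; last by rewrite ffunE mevalXU lvarK.
    by move/Vfs: Vx; apply; apply: mem_tnth.
  - by rewrite g_copy !ffunE !mevalXU !lvarK repK subrr.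
  - by apply/ffunP => v; rewrite !ffunE mevalXU ffunE mevalXU lvarK repK.
have y_copy t : y (lvar t) = y (lvar (rep (original t))).
  by have /eqP := Wy (inr t); rewrite g_copy subr_eq0 => /eqP.
split.
  apply/Vfs => f /(tnthP (in_tuple fs))[i ->].
  rewrite -(g_poly (fun t => y (lvar t))) => [|t]; first exact: Wy.
  by rewrite ffunE mevalXU.
by apply/ffunP => i; rewrite !ffunE mevalXU ffunE mevalXU -y_copy vtK.
Qed.
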